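(* Let $X\subseteq\mathbb P(V)$ be an embedded projective variety with a Seshadri stratification given by subvarieties $X_p$ and extremal functions $f_p$, $p\in A$. Let $\leq^t$ be any linearization of the partial order $\leq$ on $A$ and let $\mathcal V=\mathcal V_{\leq^t}$ be the associated quasi-valuation. Then for each extremal function $f_q$, $q\in A$, we have $\mathcal V(f_q)=e_q$.
   Context: $\mathbb K$ is an algebraically closed field, $V$ a finite-dimensional $\mathbb K$-vector space, $X\subseteq\mathbb P(V)$ an (irreducible) embedded projective variety, $\hat X\subseteq V$ its affine cone, $\mathbb K[\hat X]$ its graded homogeneous coordinate ring. **Seshadri stratification.** Let $X_p$, $p\in A$, be a finite collection of projective subvarieties of $X$, with cones $\hat X_p$; partially order $A$ by $p\leq q\iff X_p\subseteq X_q$ and assume $A$ has a unique maximal element $p_{\max}$, with $X_{p_{\max}}=X$. For each $p$ let $f_p\in\mathrm{Sym}(V^* )$ be homogeneous of degree $\geq1$. This is a Seshadri stratification (with extremal functions $f_p$) if: (S1) each $X_p$ is smooth in codimension one, and if $q<p$ is a covering relation then $X_q$ has codimension one in $X_p$; (S2) if $q\not\leq p$ then $f_q$ vanishes on $X_p$; (S3) for each $p$, set-theoretically $\{f_p=0\}\cap X_p=\bigcup_{q\text{ covered by }p}X_q$. Then all maximal chains of $A$ have the same length $r=\dim X$, $f_p$ does not vanish identically on $X_p$, and $\hat X_p\cong\mathbb A^1$ for minimal $p$. **Bonds.** For a covering $p>q$, $\nu_{p,q}$ is the discrete valuation (vanishing order) of the local ring $\mathcal O_{\hat X_p,\hat X_q}$,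 extended to $\mathbb K(\hat X_p)$, and $b_{p,q}:=\nu_{p,q}(f_p)\geq1$ is the bond. Add an element $p_{-1}$ below all minimal elements, with $\hat X_{p_{-1}}=\{0\}$; for $p$ minimal, $\nu_{p,p_{-1}}$ is the vanishing order at $0$ and $b_{p,p_{-1}}=\deg f_p$. $N$ is the least common multiple of all bonds. **Valuations.** $\mathbb Q^A$ is the space of functions $A\to\mathbb Q$, $e_p$ the indicator function of $p$. For a maximal chain $\mathfrak C:p_{\max}=p_r>\dots>p_0$ put $b_k=b_{p_k,p_{k-1}}$, $\nu_k=\nu_{p_k,p_{k-1}}$. For $g\in\mathbb K[\hat X]\setminus\{0\}$ define $g_r=g$ and, for $k=r,\dots,1$, $g_{k-1}=\big(g_k^N/f_{p_k}^{N\nu_k(g_k)/b_k}\big)\big|_{\hat X_{p_{k-1}}}$, a well-defined nonzero rational function on $\hat X_{p_{k-1}}$. Then $$\mathcal V_{\mathfrak C}(g)=\sum_{k=0}^r\frac1{N^{r-k}}\frac{\nu_k(g_k)}{b_k}e_{p_k}\in\mathbb Q^A.$$ A linearization $\leq^t$ of $\leq$ is a total order on $A$ refining $\leq$. It induces a total order, also denoted $\leq^t$, on $\mathbb Q^A$: $\underline a\leq^t\underline b$ if $\underline a=\underline b$ or, for the $\leq^t$-maximal $p$ with $\underline a(p)\neq\underline b(p)$, $\underline a(p)<\underline b(p)$. The quasi-valuation is $\mathcal V_{\leq^t}(g):=\min_{\mathfrak C}\mathcal V_{\mathfrak C}(g)$, minimum with respect to $\leq^t$ over all maximal chains $\mathfrak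 C$ in $A$. Extremal functions are viewed as elements of $\mathbb K[\hat X]$ by restriction. *)

(* Defs.v *)
From HB Require Import structures.
From mathcomp Require Import all_boot all_order all_algebra.
From mathcomp Require Import boolp classical_sets.
From mathcomp Require Import mpoly.

Set Implicit Arguments.
Unset Strict Implicit.
Unset Printing Implicit Defensive.

Import Order.TTheory GRing.Theory Num.Theory.
Local Open Scope classical_set_scope.
Local Open Scope ring_scope.
Local Open Scope quotient_scope.

Local Notation "x %:F" := (tofrac x).

Section Projective.
Variables (K : closedFieldType) (V : vectType K).

(* Sym(V^* ): the variable 'X_i is the i-th coordinate form of the basis
   vbasis {:V} of V. *)
Definition Sym := {mpoly K[\dim {: V}]}.

Definition evalS (f : Sym) (v : V) : K :=
  f.@[fun i => coord (vbasis {: V}) i v].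

Definition PV := {L : {vspace V} | \dim L == 1%N}.

Definition proj_zeros (S : set Sym) : set PV :=
  [set L : PV | forall f, S f -> forall v, v \in val L -> evalS f v = 0].

Definition proj_closed (Y : set PV) : Prop :=
  exists2 S : set Sym, (forall f, S f -> exists d, f \is d.-homog)
                     & Y = proj_zeros S.

Definition proj_irreducible (Y : set PV) : Prop :=
  Y !=set0 /\
  forall Y1 Y2, proj_closed Y1 -> proj_closed Y2 ->
    Y `<=` Y1 `|` Y2 -> Y `<=` Y1 \/ Y `<=` Y2.

Record projVariety := ProjVariety {
  pts :> set PV;
  pts_closed : proj_closed pts;
  pts_irreducible : proj_irreducible pts
}.

Definition cone (X : projVariety) : set V :=
  [set v | v = 0 \/ exists2 L : PV, pts X L & v \in val L].

Definition vanishing (W : set V) : {pred Sym} :=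
  fun f => `[< forall v, W v -> evalS f v = 0 >].

Definition cone_ideal (X : projVariety) : Sym -> bool := vanishing (cone X).

Section ConeIdealPrime.

Lemma vanishingP (W : set V) f :
  reflect (forall v, W v -> evalS f v = 0) (f \in vanishing W).
Proof. exact: asboolP. Qed.

Lemma evalSD f g v : evalS (f + g) v = evalS f v + evalS g v.
Proof. exact: mevalD. Qed.

Lemma evalSM f g v : evalS (f * g) v = evalS f v * evalS g v.
Proof. exact: mevalM. Qed.

Lemma evalS_homog d f t v :
  f \is d.-homog -> evalS f (t *: v) = t ^+ d * evalS f v.
Proof.
move=> /dhomogP hf; rewrite /evalS !mevalE mulr_sumr !big_seq.
apply: eq_bigr => m /hf /= <-; rewrite mulrCA; congr (_ * _).
have -> : t ^+ mdeg m = \prod_i t ^+ m i by rewrite mdegE prodrXr.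
rewrite -big_split /=.
by apply: eq_bigr => i _; rewrite linearZ /= exprMn.
Qed.

Definition line_poly f v : {poly K} :=
  \poly_(d < msize f) evalS (pihomog mdeg d f) v.

Lemma line_polyE f v t : (line_poly f v).[t] = evalS f (t *: v).
Proof.
rewrite horner_poly [in RHS](pihomog_partitionE (mf := mdeg) (leqnn (msize f))).
rewrite /evalS raddf_sum /=; apply: eq_bigr => d _.
by have := evalS_homog t v (pihomogP mdeg d f); rewrite /evalS mulrC => ->.
Qed.

Lemma poly_eq0_horner (p : {poly K}) : (forall t, p.[t] = 0) -> p = 0.
Proof.
move=> hp; apply/eqP; apply: contraT => /closed_nonrootP[t].
by rewrite /root hp eqxx.
Qed.

Lemma line_poly_eq0 f (L : PV) v : v \in val L -> v != 0 ->
  (line_poly f v = 0) <-> (forall w, w \in val L -> evalS f w = 0).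
Proof.
move=> vL v0; split=> [f0 w wL|f0]; last first.
  by apply: poly_eq0_horner => t; rewrite line_polyE f0 // memvZ.
have LE : val L = <[v]>%VS.
  by apply/eqP; rewrite eq_sym eqEdim -memvE vL (eqP (valP L)) dim_vline v0.
by move: wL; rewrite LE => /vlineP[t ->]; rewrite -line_polyE f0 horner0.
Qed.

Lemma pt_vector (L : PV) : exists2 v, v \in val L & v != 0.
Proof.
by exists (vpick (val L)); rewrite ?memv_pick // vpick0 -dimv_eq0 (eqP (valP L)).
Qed.

Lemma coneP (X : projVariety) f :
  reflect (forall L : PV, pts X L -> forall v, v \in val L -> evalS f v = 0)
          (f \in vanishing (cone X)).
Proof.
apply: (iffP (vanishingP _ _)) => [h L XL v vL|h v].
  by apply: h; right; exists L.
case=> [->|[L XL vL]]; last exact: h vL.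
by have [L0 XL0] := (pts_irreducible X).1; apply: h XL0 _ (mem0v _).
Qed.

Lemma zeros_closed f :
  proj_closed [set L : PV | forall v, v \in val L -> evalS f v = 0].
Proof.
exists [set g | exists d : nat, g = pihomog mdeg d f].
  by move=> _ [d ->]; exists d; apply: pihomogP.
have coefE v d : (line_poly f v)`_d = evalS (pihomog mdeg d f) v.
  rewrite coef_poly; case: ltnP => // lefd.
  rewrite pihomogE big_seq_cond big_pred0 ?/evalS ?meval0 // => m.
  apply/negP => /andP[/msize_mdeg_lt ltm /eqP md].
  by move: ltm; rewrite md ltnNge lefd.
apply/seteqP; split=> L /= h.
  move=> _ [d ->] v vL.
  have [->|v0] := eqVneq v 0.
    have [u uL u0] := pt_vector L.
    have := coefE u d; rewrite ((line_poly_eq0 f uL u0).2 h) coef0.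
    have := evalS_homog 0 u (pihomogP mdeg d f); rewrite scale0r => -> <-.
    by rewrite mulr0.
  by rewrite -coefE ((line_poly_eq0 f vL v0).2 h) coef0.
have [u uL u0] := pt_vector L; apply/(line_poly_eq0 f uL u0).
by apply/polyP => d; rewrite coefE coef0; apply: h uL; exists d.
Qed.

Lemma cone_ideal_closed X : idealr_closed (cone_ideal X).
Proof.
split.
- by apply/vanishingP => v _; apply: meval0.
- have [L XL] := (pts_irreducible X).1.
  apply/negP => /coneP /(_ L XL 0 (mem0v _)); rewrite /evalS meval1.
  by apply/eqP; rewrite oner_eq0.
- move=> a f g /vanishingP hf /vanishingP hg; apply/vanishingP => v Wv.
  by rewrite evalSD evalSM hf // hg // mulr0 addr0.
Qed.

Lemma cone_ideal_prime X : prime_idealr_closed (cone_ideal X).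
Proof.
move=> f g /coneP fg0.
have [] := (pts_irreducible X).2 _ _ (zeros_closed f) (zeros_closed g).
- move=> L XL; have [u uL u0] := pt_vector L.
  have : line_poly f u * line_poly g u == 0.
    apply/eqP/poly_eq0_horner => t.
    by rewrite hornerM !line_polyE -evalSM (fg0 _ XL) ?memvZ.
  rewrite mulf_eq0 => /orP[] /eqP /(line_poly_eq0 _ uL u0) ?; by [left|right].
- by move=> h; apply/orP; left; apply/coneP.
- by move=> h; apply/orP; right; apply/coneP.
Qed.

End ConeIdealPrime.

HB.instance Definition _ X :=
  isIdealr.Build Sym (cone_ideal X) (cone_ideal_closed X).
HB.instance Definition _ X :=
  isPrimeIdealrClosed.Build Sym (cone_ideal X) (@cone_ideal_prime X).

Definition coord_ring (X : projVariety) := 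
  {ideal_quot (cone_ideal X : prime_idealr Sym)}.

HB.instance Definition _ X := GRing.ComNzRing.on (coord_ring X).

Section CoordRingDomain.
Variable X : projVariety.
Implicit Types x y : coord_ring X.

Definition coord_unit : {pred coord_ring X} :=
  fun x => `[< exists y, y * x = 1 >].

Definition coord_inv x := xget x [set y | y * x = 1].

Lemma coord_mulVr : {in coord_unit, left_inverse 1 coord_inv *%R}.
Proof.
by move=> x /asboolP[y yx]; rewrite /coord_inv; case: xgetP => // /(_ y).
Qed.

Lemma coord_unitP x y : y * x = 1 -> coord_unit x.
Proof. by move=> yx; apply/asboolP; exists y. Qed.

Lemma coord_inv_out : {in [predC coord_unit], coord_inv =1 id}.
Proof.
move=> x /negP nx; rewrite /coord_inv; case: xgetP => // y _ yx.
by case: nx; apply: coord_unitP yx.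
Qed.

HB.instance Definition _ := GRing.ComNzRing_hasMulInverse.Build (coord_ring X)
  coord_mulVr coord_unitP coord_inv_out.

Lemma coord_idomain x y : x * y = 0 -> (x == 0) || (y == 0).
Proof. exact: (@Quotient.rquot_IdomainAxiom _ (cone_ideal X)). Qed.

HB.instance Definition _ :=
  GRing.ComUnitRing_isIntegral.Build (coord_ring X) coord_idomain.

End CoordRingDomain.

(* The image of f in K[\hat X]. *)
Definition coord_res (X : projVariety) (f : Sym) : coord_ring X :=
  \pi_(coord_ring X) f.

Definition fun_field (X : projVariety) := {fraction (coord_ring X)}.

Definition ratio_on (X : projVariety) (a b : Sym) : fun_field X :=
  (coord_res X a)%:F / (coord_res X b)%:F.

(* The local ring of \hat X along the subvariety W of V, where W is \hat Z
   for a subvariety Z of X, or {0}. *)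
Definition cone_loc (X : projVariety) (W : set V) : set (fun_field X) :=
  [set z | exists a b, b \notin vanishing W /\ z = ratio_on X a b].

Definition cone_loc_max (X : projVariety) (W : set V) : set (fun_field X) :=
  [set z | exists a b, [/\ a \in vanishing W, b \notin vanishing W
                         & z = ratio_on X a b]].

(* The local ring of X along Z consists of the fractions of degree 0; it is
   seen here as a subring of K(\hat X). *)
Definition proj_loc (X Z : projVariety) : set (fun_field X) :=
  [set z | exists d a b, [/\ a \is d.-homog, b \is d.-homog,
                             b \notin cone_ideal Z & z = ratio_on X a b]].

Definition proj_loc_max (X Z : projVariety) : set (fun_field X) :=
  [set z | exists d a b, [/\ a \is d.-homog, b \is d.-homog, a \in cone_ideal Z,
                             b \notin cone_ideal Z & z = ratio_on X a b]].

(* The restriction of g to \hat Y; meaningful when \hat Y is contained in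
   \hat X and g is regular at the generic point of \hat Y. *)
Definition restrict (X Y : projVariety) (g : fun_field X) : fun_field Y :=
  xget 0 [set h | exists a b, [/\ b \notin cone_ideal Y, g = ratio_on X a b
                                & h = ratio_on Y a b]].

Definition var_chain (Z X : projVariety) (n : nat) : Prop :=
  exists W : nat -> projVariety,
    [/\ W 0%N = Z, W n = X & forall i, (i < n)%N -> W i `<` W i.+1].

Definition has_codim (Z X : projVariety) (n : nat) : Prop :=
  var_chain Z X n /\ forall m, var_chain Z X m -> (m <= n)%N.

End Projective.

Arguments cone_loc {K V} X W _.
Arguments cone_loc_max {K V} X W _.
Arguments proj_loc {K V} X Z _.
Arguments proj_loc_max {K V} X Z _.

Section LocalRings.
Variables (F : fieldType) (O m : set F).

(* For a local ring (O, m) of Krull dimension n. *)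
Definition regular_of_dim (n : nat) : Prop :=
  exists t : 'I_n -> F, (forall i, m (t i)) /\
    forall x, m x -> exists c : 'I_n -> F,
      (forall i, O (c i)) /\ x = \sum_(i < n) c i * t i.

Fixpoint max_pow (n : nat) : set F :=
  if n is n'.+1 then
    [set x | exists k (a b : 'I_k -> F),
       [/\ forall i, m (a i), forall i, max_pow n' (b i)
         & x = \sum_(i < k) a i * b i]]
  else O.

Definition order (x : F) : nat :=
  xget 0%N [set n | max_pow n x /\ ~ max_pow n.+1 x].

(* Vanishing order: order(x) = max {n | x \in m^n} on O, extended to quotients
   of elements of O by order(x/y) = order(x) - order(y). When O is a discrete
   valuation ring with fraction field F this is its valuation. *)
Definition valuation (z : F) : int :=
  xget 0 [set k : int | exists x y : F,
    [/\ O x, O y, x != 0 & y != 0] /\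
    (z = x / y /\ k = (order x)%:Z - (order y)%:Z)].

End LocalRings.

(* The local rings of X of dimension one, i.e. at the subvarieties of
   codimension one, are regular. *)
Definition smooth_in_codim1 (K : closedFieldType) (V : vectType K)
    (X : projVariety V) : Prop :=
  forall Z : projVariety V, has_codim Z X 1 ->
    regular_of_dim (proj_loc X Z) (proj_loc_max X Z) 1.

Definition covered_by disp (A : finPOrderType disp) (q p : A) : bool :=
  (q < p)%O && [forall z, ~~ (q < z < p)%O].

Record seshadri (K : closedFieldType) (V : vectType K) (X : projVariety V)
    disp (A : finPOrderType disp) := Seshadri {
  strat :> A -> projVariety V;
  extremal : A -> Sym V;
  p_max : A;
  strat_sub : forall p, strat p `<=` X;
  strat_le : forall p q, (p <= q)%O <-> strat p `<=` strat q;
  p_max_unique : forall p, (forall q, (p <= q)%O -> q = p) <-> p = p_max;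
  strat_p_max : strat p_max = X;
  extremal_homog : forall p, exists2 d, (0 < d)%N & extremal p \is d.-homog;
  S1_smooth : forall p, smooth_in_codim1 (strat p);
  S1_codim : forall p q, covered_by q p -> has_codim (strat q) (strat p) 1;
  S2 : forall p q, ~~ (q <= p)%O ->
    strat p `<=` proj_zeros [set extremal q];
  S3 : forall p, proj_zeros [set extremal p] `&` strat p =
    \bigcup_(q in [set q | covered_by q p]) strat q
}.

Section QuasiValuation.
Variables (K : closedFieldType) (V : vectType K) (X : projVariety V).
Variables (disp : Order.disp_t) (A : finPOrderType disp).
Variable S : seshadri X A.

(* In option A, None stands for the added element p_{-1}. *)
Definition ext_cone (q : option A) : set V :=
  if q is Some q then cone (S q) else [set 0].

Definition ext_covered_by (q : option A) (p : A) : bool :=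
  if q is Some q then covered_by q p else [forall z, ~~ (z < p)%O].

Definition nu (p : A) (q : option A) : fun_field (S p) -> int :=
  valuation (cone_loc (S p) (ext_cone q)) (cone_loc_max (S p) (ext_cone q)).

Definition extremal_on (p : A) : fun_field (S p) :=
  (coord_res (S p) (extremal S p))%:F.

(* The valuation of f_p is a positive integer; the absolute value only
   serves to turn it into a natural number. *)
Definition bond (p : A) (q : option A) : nat :=
  if q is Some _ then `|nu q (extremal_on p)|%N else (msize (extremal S p)).-1.

Definition bond_lcm : nat :=
  \big[lcmn/1%N]_(p : A) \big[lcmn/1%N]_(q : option A | ext_covered_by q p)
    bond p q.

(* The quotient N * nu / b is exact, since b divides N. *)
Definition chain_step (p q : A) (g : fun_field (S p)) : fun_field (S q) :=
  restrict (S q) (g ^+ bond_lcm /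
    extremal_on p ^ ((bond_lcm%:Z * nu (Some q) g) %/ (bond p (Some q))%:Z)%Z).

Definition indic (p : A) : {ffun A -> rat} := [ffun x => (x == p)%:R].

(* The sum over k <= j of c / N^(j-k) * nu_k(g_k) / b_k * e_{p_k}, for
   p = p_j, C = [:: p_{j-1}; ...; p_0] and g = g_j. *)
Fixpoint chain_sum (c : rat) (p : A) (C : seq A) :
    fun_field (S p) -> {ffun A -> rat} :=
  let term q g := [ffun x => c * ((nu q g)%:~R / (bond p q)%:R) * indic p x] in
  match C with
  | [::] => fun g => term None g
  | q :: C' => fun g =>
      term (Some q) g + chain_sum (c / bond_lcm%:R) C' (chain_step q g)
  end.

(* A maximal chain, as the decreasing list [:: p_r; ...; p_0]. *)
Definition maximal_chain (C : seq A) : Prop :=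
  sorted >%O C /\
  maxset (fun D : {set A} => [forall x in D, forall y in D, (x >=< y)%O])
         [set:: C]%SET.

(* As p_r = p_max and X_{p_max} = X, the restriction below is the identity. *)
Definition chain_valuation (C : seq A) (g : coord_ring X) : {ffun A -> rat} :=
  if C is p :: C' then chain_sum 1 C' (restrict (S p) (g%:F)) else 0.

Definition linearization (le_t : rel A) : Prop :=
  [/\ reflexive le_t, antisymmetric le_t, transitive le_t, total le_t
    & forall p q, (p <= q)%O -> le_t p q].

Definition lex_le (le_t : rel A) (a b : {ffun A -> rat}) : Prop :=
  a = b \/ exists p, [/\ a p != b p, forall q, a q != b q -> le_t q p
                       & a p < b p].

Definition quasi_valuation (le_t : rel A) (g : coord_ring X) : {ffun A -> rat} :=
  xget 0 [set v | (exists2 C, maximal_chain C & v = chain_valuation C g) /\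
                  forall C, maximal_chain C -> lex_le le_t v (chain_valuation C g)].

End QuasiValuation.

(* Main.v *)
(** Let N be the lcm of the bonds and C a maximal chain. Along C, as long as q <= p_(k-1),
    the function f_q does not vanish on X_(p_(k-1)), so nu_k = 0 and the next function is
    again a power of f_q. If C passes through q, then at p_k = q the function is
    f_q^(N^(r-k)), which contributes e_q and is followed by the constant 1; hence
    V_C(f_q) = e_q. Otherwise there is a k with q < p_k but not q <= p_(k-1);
    there f_q vanishes on X_(p_(k-1)), so that V_C(f_q) is positive at p_k > q and zero
    at every element not below p_k; hence e_q <= V_C(f_q).

    This needs the vanishing orders to be honest valuations. At a cover q < p, a
    uniformizer of the local ring of X_p along X_q also generates the maximal ideal
    of the local ring of the cones, and Hilbert's basis theorem excludes elements of
    infinite order. At the vertex of a cone, the order of a function is the lowest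
    degree of its homogeneous components, which is additive since the coordinate
    ring is a graded domain. *)

Require Import Defs.
From mathcomp Require Import all_boot all_order all_algebra.
From mathcomp Require Import boolp classical_sets.
From mathcomp Require Import mpoly.
From mathcomp Require Import zify ring.

Set Implicit Arguments.
Unset Strict Implicit.
Unset Printing Implicit Defensive.

Import Order.TTheory GRing.Theory Num.Theory.
Local Open Scope classical_set_scope.
Local Open Scope ring_scope.

Local Notation "x %:F" := (tofrac x).

(** * Noetherian rings *)

Section Noetherian.

Definition in_span (R : comNzRingType) (n : nat) (a : nat -> R) (x : R) : Prop :=
  exists c : nat -> R, x = \sum_(i < n) c i * a i.

(** Sequential form of the ascending chain condition. Every use below feeds it one explicit sequence
    and needs a single relation among its terms. *)
Definition noetherian (R : comNzRingType) : Prop :=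
  forall a : nat -> R, exists n, in_span n a (a n).

(** Dependent choice in which each new term may depend on the list of all earlier ones. *)
Lemma mkseq_choice (T : choiceType) (x0 : T) (P : seq T -> T -> Prop) :
  (forall s, exists x, P s x) -> exists a : nat -> T, forall n, P (mkseq a n) (a n).
Proof.
move=> Pex; pose next s := xget x0 (P s).
have nextP s : P s (next s) by apply: xgetPex.
pose G := fix G n := if n is m.+1 then rcons (G m) (next (G m)) else [::].
exists (fun n => next (G n)) => n.
suff -> : mkseq (fun n => next (G n)) n = G n by [].
by elim: n => //= n IH; rewrite mkseqS IH.
Qed.

Lemma in_span_gen (R : comNzRingType) n (a : nat -> R) i :
  (i < n)%N -> in_span n a (a i).
Proof.
move=> lt_in; exists (fun j => (j == i)%:R).
rewrite (bigD1 (Ordinal lt_in)) //= eqxx mul1r big1 ?addr0 // => j ne_ji.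
by rewrite -val_eqE /= in ne_ji; rewrite (negbTE ne_ji) mul0r.
Qed.

Lemma in_span0 (R : comNzRingType) n (a : nat -> R) : in_span n a 0.
Proof. by exists (fun=> 0); rewrite big1 // => i _; rewrite mul0r. Qed.

Lemma in_spanD (R : comNzRingType) n (a : nat -> R) x y :
  in_span n a x -> in_span n a y -> in_span n a (x + y).
Proof.
move=> [c ->] [d ->]; exists (fun i => c i + d i).
by rewrite -big_split; apply: eq_bigr => i _; rewrite mulrDl.
Qed.

Lemma in_spanM (R : comNzRingType) n (a : nat -> R) r x :
  in_span n a x -> in_span n a (r * x).
Proof.
move=> [c ->]; exists (fun i => r * c i).
by rewrite mulr_sumr; apply: eq_bigr => i _; rewrite mulrA.
Qed.

Lemma in_span_trans (R : comNzRingType) m n (a b : nat -> R) x :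
  (forall i, (i < m)%N -> in_span n b (a i)) -> in_span m a x -> in_span n b x.
Proof.
move=> ab [c ->]; apply: big_ind; [exact: in_span0|exact: in_spanD|].
by move=> i _; apply: in_spanM; apply: ab.
Qed.

Lemma in_spanW (R : comNzRingType) m n (a : nat -> R) x :
  (m <= n)%N -> in_span m a x -> in_span n a x.
Proof.
by move=> le_mn; apply: in_span_trans => i lt_im; apply/in_span_gen/(leq_trans lt_im).
Qed.

Lemma noetherian_image (R S : comNzRingType) (h : {rmorphism R -> S}) :
  (forall y, exists x, h x = y) -> noetherian R -> noetherian S.
Proof.
move=> h_surj noeR a.
pose a' i := xget 0 [set x | h x = a i].
have ha' i : h (a' i) = a i.
  by have [x hx] := h_surj (a i); apply: (@xgetPex _ 0 [set x | h x = a i]); exists x.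
have [n [c a'n]] := noeR a'; exists n, (fun i => h (c i)).
rewrite -ha' a'n rmorph_sum; apply: eq_bigr => i _.
by rewrite rmorphM /= ha'.
Qed.

Lemma noetherian_field (F : fieldType) : noetherian F.
Proof.
move=> a; have [a0|a0] := eqVneq (a 0%N) 0.
  by exists 0%N, (fun=> 0); rewrite big_ord0.
by exists 1%N, (fun=> a 1%N / a 0%N); rewrite big_ord1 divfK.
Qed.

(* Hilbert: if no g_0, ..., g_{n-1} generate the ideal J of the a_i, choose
   g_n in J outside their span of least degree; the leading coefficients of
   the g_n contradict the noetherianity of R. *)
Lemma noetherian_poly (R : comNzRingType) : noetherian R -> noetherian {poly R}.
Proof.
move=> noeR a; apply: contrapT => /forallNP na.
pose J x := exists n, in_span n a x.
have JD x y : J x -> J y -> J (x + y).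
  move=> [m Jx] [n Jy]; exists (maxn m n).
  by apply: in_spanD; [apply: in_spanW Jx|apply: in_spanW Jy];
     rewrite ?leq_maxl ?leq_maxr.
have JM r x : J x -> J (r * x) by move=> [m Jx]; exists m; apply: in_spanM.
have Jfg n (g : nat -> {poly R}) : (forall i, (i < n)%N -> J (g i)) ->
    exists2 x, J x & ~ in_span n g x.
  move=> Jg; have [N JN] : exists N, forall i, (i < n)%N -> in_span N a (g i).
    elim: n Jg => [|n IH] Jg; first by exists 0%N.
    have [N JN] := IH (fun i lin => Jg i (ltnW lin)).
    have [M JM'] := Jg n (ltnSn n); exists (maxn N M) => i.
    rewrite ltnS leq_eqVlt => /orP[/eqP->|/JN].
      by apply: in_spanW JM'; apply: leq_maxr.
    by apply: in_spanW; apply: leq_maxl.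
  exists (a N); first by exists N.+1; apply: in_span_gen.
  by move=> /(in_span_trans JN); apply: na.
(* The premise on [s] makes [P] satisfiable for every list, as [mkseq_choice] demands; strong
   induction discharges it once the sequence exists. *)
pose P (s : seq {poly R}) x := (forall i, (i < size s)%N -> J s`_i) ->
  [/\ J x, ~ in_span (size s) (nth 0 s) x &
   forall y, J y -> ~ in_span (size s) (nth 0 s) y -> (size x <= size y)%N].
have [s|g gP] := @mkseq_choice _ 0 P.
  have [Js|nJs] := pselect (forall i, (i < size s)%N -> J s`_i); last by exists 0.
  have [x Jx nx] := Jfg _ _ Js.
  pose Q n := `[< exists x, [/\ J x, ~ in_span (size s) (nth 0 s) x & size x = n] >].
  have Qex : exists n, Q n by exists (size x); apply/asboolP; exists x.
  have [n /asboolP[y [Jy ny <-]] y_min] := ex_minnP Qex.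
  by exists y => _; split=> // z Jz nz; apply: y_min; apply/asboolP; exists z.
have spanE n x : in_span (size (mkseq g n)) (nth 0 (mkseq g n)) x <-> in_span n g x.
  rewrite size_mkseq; split=> -[c ->]; exists c;
    by apply: eq_bigr => i _; rewrite nth_mkseq.
have gn n : [/\ J (g n), ~ in_span n g (g n) &
    forall y, J y -> ~ in_span n g y -> (size (g n) <= size y)%N].
  elim/ltn_ind: n => n IH; have [i|Jn nn mn] := gP n.
    by rewrite size_mkseq => lt_in; rewrite nth_mkseq //; case: (IH i).
  by split=> // [/spanE //|y Jy ny]; apply: mn => // /spanE.
have [n [c lead_n]] := noeR (fun i => lead_coef (g i)).
have [Jn nn mn] := gn n.
have size_g i : (i < n)%N -> (size (g i) <= size (g n))%N.
  move=> lt_in; have [_ _] := gn i; apply=> // h.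
  by apply: nn; apply: in_spanW h; apply: ltnW.
(* Shifting each earlier [g i] up to the degree of [g n] gives [u] the leading term of [g n]. Then
   [g n - u] is smaller but still in [J] and outside the span, against the minimal size of [g n]. *)
pose u := \sum_(i < n) (c i)%:P * 'X^(size (g n) - size (g i)) * g i.
have u_span : in_span n g u.
  by exists (fun i => (c i)%:P * 'X^(size (g n) - size (g i))).
have Ju : J u.
  apply: big_ind => [|x y Jx Jy|i _]; last by apply: JM; case: (gn i).
    by exists 0%N; apply: in_span0.
  exact: JD.
have Jd : J (g n - u) by apply: JD => //; rewrite -mulN1r; apply: JM.
have nd : ~ in_span n g (g n - u).
  by move=> h; apply: nn; rewrite -(subrK u (g n)); apply: in_spanD.
have := mn _ Jd nd; rewrite leqNgt => /negP; apply.
have gn0 : g n != 0.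
  by apply/eqP => g0; apply: nn; rewrite g0; apply: in_span0.
have sz_gt0 : (0 < size (g n))%N by rewrite size_poly_gt0.
rewrite -[X in (_ < X)%N](prednK sz_gt0) ltnS; apply/leq_sizeP => j.
rewrite leq_eqVlt coefB coef_sum => /orP[/eqP<-|lt_j]; last first.
  have le_j : (size (g n) <= j)%N by rewrite -(prednK sz_gt0).
  rewrite nth_default // big1 ?subr0 // => i _; rewrite -mulrA coefCM coefXnM.
  case: ltnP => _; rewrite ?mulr0 // nth_default ?mulr0 //.
  by rewrite leq_subRL ?subnK ?size_g // (leq_trans (leq_subr _ _)).
rewrite -lead_coefE lead_n -sumrB big1 // => i _.
apply/eqP; rewrite subr_eq0 -mulrA coefCM coefXnM; apply/eqP.
(* For a nonzero [g i] the truncated subtractions in the indices are exact. *)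
have sz_i : (0 < size (g i))%N.
  rewrite size_poly_gt0; apply/eqP => g0.
  by have [_ + _] := gn i; rewrite g0; apply; apply: in_span0.
case: ltnP => [|_]; last first.
  by rewrite lead_coefE; congr (_ * _`_ _); have := size_g i (ltn_ord i); lia.
by have := size_g i (ltn_ord i); lia.
Qed.

(** Induction on [n]: the ring in [n.+1] variables is the image of the univariate polynomials over
    the ring in [n] variables, the indeterminate going to the last variable. *)
Lemma noetherian_mpoly (F : fieldType) n : noetherian {mpoly F[n]}.
Proof.
elim: n => [|n IH].
  apply: (@noetherian_image _ _ (@mpolyC 0 F)); last exact: noetherian_field.
  move=> p; exists p@_0; apply/mpolyP => m.
  by rewrite mcoeffC (_ : m = 0%MM) ?eqxx ?mulr1 //; apply/mnmP => -[].
pose h : {rmorphism {poly {mpoly F[n]}} -> {mpoly F[n.+1]}} :=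
  horner_eval ('X_ord_max : {mpoly F[n.+1]}) \o map_poly (@mwiden n F).
apply: (@noetherian_image _ _ h); last exact: noetherian_poly.
have hC c : h (c%:MP)%:P = c%:MP.
  rewrite /h /= /horner_eval map_polyC hornerC /=; exact: mwidenC.
have hX i : exists x, h x = 'X_i.
  case: (unliftP ord_max i) => [j|] ->; last first.
    by exists 'X; rewrite /h /= /horner_eval map_polyX hornerX.
  exists ('X_j)%:P; rewrite /h /= /horner_eval map_polyC hornerC /=.
  rewrite mwidenX mnmwiden1; congr 'X_[U_(_)].
  by apply: val_inj; rewrite /= /bump leqNgt ltn_ord.
elim/mpolyind => [|c m p _ _ [x hx]]; first by exists 0; rewrite rmorph0.
have [y hy] : exists y, h y = 'X_[m].
  rewrite mpolyXE_id; elim/big_ind: _ => [|_ _ [x1 <-] [x2 <-]|i _].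
  - by exists 1; rewrite rmorph1.
  - by exists (x1 * x2); rewrite rmorphM.
  - by have [z hz] := hX i; exists (z ^+ m i); rewrite rmorphXn hz.
by exists ((c%:MP)%:P * y + x); rewrite rmorphD rmorphM hC hx hy mul_mpolyC.
Qed.

End Noetherian.

(** * Orders in local rings *)

Section Order.
Variable F : fieldType.
Implicit Types (O m : set F) (x y z t : F) (n : nat).

Record prime_pair O m : Prop := PrimePair {
  pairO1 : O 1;
  pairOD : forall x y, O x -> O y -> O (x + y);
  pairOM : forall x y, O x -> O y -> O (x * y);
  pair_sub : m `<=` O;
  pair0 : m 0;
  pairD : forall x y, m x -> m y -> m (x + y);
  pairM : forall x y, O x -> m y -> m (x * y);
  pair1 : ~ m 1;
  pair_prime : forall x y, O x -> O y -> m (x * y) -> m x \/ m y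
}.

(** Relational form of [order]: it fails on elements of infinite order, where [order] falls back to
    0. *)
Definition has_order O m n x := max_pow O m n x /\ ~ max_pow O m n.+1 x.

(** The two facts that turn the order into an honest valuation: no nonzero element of infinite
    order, and additivity on products. *)
Definition additive_order O m : Prop :=
  (forall x, O x -> x != 0 -> exists n, has_order O m n x) /\
  (forall a b x y, has_order O m a x -> has_order O m b y ->
    has_order O m (a + b) (x * y)).

Section Pair.
Variables (O m : set F).
Hypothesis Om : prime_pair O m.

Lemma sum_multiple (I : Type) (r : seq I) (P : pred I) (E : I -> F) z :
  (forall i, P i -> exists2 s, O s & E i = s * z) ->
  exists2 s, O s & \sum_(i <- r | P i) E i = s * z.
Proof.
move=> Ez.
apply: (big_ind (fun y => exists2 s, O s & y = s * z)) => [|_ _ [s Os ->] [u Ou ->]|].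
- by exists 0; rewrite ?mul0r //; apply/(pair_sub Om)/(pair0 Om).
- by exists (s + u); rewrite ?mulrDl //; apply: (pairOD Om).
- exact: Ez.
Qed.

Lemma max_pow0 n : max_pow O m n 0.
Proof.
case: n => [|n] /=; first by apply: (pair_sub Om); apply: (pair0 Om).
by exists 0%N, (fun=> 0), (fun=> 0); split; [by case|by case|by rewrite big_ord0].
Qed.

Lemma max_powD n x y :
  max_pow O m n x -> max_pow O m n y -> max_pow O m n (x + y).
Proof.
case: n => [|n] /=; first exact: (pairOD Om).
move=> [k [a [b [ma mb ->]]]] [l [c [d [mc md ->]]]].
exists (k + l)%N,
  (fun i => match split i with inl j => a j | inr j => c j end),
  (fun i => match split i with inl j => b j | inr j => d j end).
split=> [i|i|]; try by case: (split i).
rewrite big_split_ord /=; congr (_ + _); apply: eq_bigr => i _.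
  by rewrite (unsplitK (inl i)).
by rewrite (unsplitK (inr i)).
Qed.

Lemma max_powS n x y : m x -> max_pow O m n y -> max_pow O m n.+1 (x * y).
Proof.
by move=> mx my; exists 1%N, (fun=> x), (fun=> y); split=> //; rewrite big_ord1.
Qed.

Lemma max_powS_ind n (P : F -> Prop) :
  P 0 -> (forall x y, P x -> P y -> P (x + y)) ->
  (forall x y, m x -> max_pow O m n y -> P (x * y)) ->
  forall x, max_pow O m n.+1 x -> P x.
Proof.
move=> P0 PD PM _ [k [a [b [ma mb ->]]]]; apply: big_ind => // i _.
exact: (PM _ _ (ma i) (mb i)).
Qed.

Lemma max_powW n x : max_pow O m n.+1 x -> max_pow O m n x.
Proof.
elim: n x => [|n IH] x; apply: max_powS_ind => [||{}x y mx my].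
- exact: max_pow0.
- exact: max_powD.
- by apply: (pairOM Om) => //; apply: (pair_sub Om).
- exact: max_pow0.
- exact: max_powD.
- by apply: max_powS => //; apply: IH.
Qed.

Lemma max_pow_le k n x : (k <= n)%N -> max_pow O m n x -> max_pow O m k x.
Proof.
elim: n => [|n IH]; first by rewrite leqn0 => /eqP->.
by rewrite leq_eqVlt => /orP[/eqP->//|/IH + /max_powW].
Qed.

Lemma max_pow1 x : max_pow O m 1 x -> m x.
Proof.
apply: max_powS_ind => [||y z my Oz]; [exact: (pair0 Om)|exact: (pairD Om)|].
by rewrite mulrC; apply: (pairM Om).
Qed.

Lemma has_order_O n x : has_order O m n x -> O x.
Proof. by case=> /(max_pow_le (leq0n n)). Qed.

Lemma has_order_neq0 n x : has_order O m n x -> x != 0.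
Proof. by case=> _ nx; apply/eqP => x0; apply: nx; rewrite x0; apply: max_pow0. Qed.

Lemma has_order_uniq a b x : has_order O m a x -> has_order O m b x -> a = b.
Proof.
move=> [ax nax] [bx nbx]; apply/eqP; rewrite eqn_leq (leqNgt a) (leqNgt b).
apply/andP; split; apply/negP => lt.
  exact: nbx (max_pow_le lt ax).
exact: nax (max_pow_le lt bx).
Qed.

Lemma has_order0 x : O x -> ~ m x -> has_order O m 0 x.
Proof. by move=> Ox nmx; split=> // /max_pow1. Qed.

Lemma has_order1 : has_order O m 0 1.
Proof. by apply: has_order0; [apply: (pairO1 Om)|apply: (pair1 Om)]. Qed.

Lemma has_order_gt0 n x : has_order O m n x -> m x -> (0 < n)%N.
Proof.
case: n => // -[Ox nx mx]; case: nx; rewrite -[x]mulr1.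
by apply: max_powS => //; apply: (pairO1 Om).
Qed.

Lemma orderE n x : has_order O m n x -> Defs.order O m x = n.
Proof.
by move=> hx; apply: xget_unique => // k hk; apply: has_order_uniq hk hx.
Qed.

Hypothesis add : additive_order O m.

Lemma has_orderM a b x y :
  has_order O m a x -> has_order O m b y -> has_order O m (a + b) (x * y).
Proof. exact: add.2. Qed.

Lemma has_orderX a x k : has_order O m a x -> has_order O m (k * a) (x ^+ k).
Proof.
move=> hx; elim: k => [|k IH]; first by rewrite expr0; apply: has_order1.
by rewrite exprS mulSn; apply: has_orderM.
Qed.

Lemma valuationE a x : has_order O m a x -> valuation O m x = a%:Z.
Proof.
move=> hx; have x0 := has_order_neq0 hx; have Ox := has_order_O hx.
apply: xget_unique.
  exists x, 1; split; last by rewrite divr1 (orderE hx) (orderE has_order1) subr0.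
  by split; rewrite ?oner_neq0 //; apply: (pairO1 Om).
move=> _ [y [z [[Oy Oz y0 z0] [xyz ->]]]].
have [c hy] := add.1 _ Oy y0; have [d hz] := add.1 _ Oz z0.
have hy' : has_order O m (a + d) y.
  by have := has_orderM hx hz; rewrite xyz divfK.
by rewrite (orderE hy') (orderE hz) PoszD addrK.
Qed.

End Pair.

(** * Orders when the ideal [m] is principal *)

Section Principal.
Variables (O m : set F) (t : F).
Hypotheses (Om : prime_pair O m) (mt : m t).
Hypothesis m_gen : forall x, m x -> exists2 s, O s & x = s * t.

Lemma max_pow_principal n x :
  max_pow O m n x <-> exists2 s, O s & x = s * t ^+ n.
Proof.
elim: n x => [|n IH] x.
  by split=> [Ox|[s Os ->]]; [exists x|]; rewrite ?mulr1.
split=> [|[s Os ->]]; last first.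
  rewrite exprS mulrCA; apply: max_powS => //; apply/IH; by exists s.
apply: (max_powS_ind (P := fun z => exists2 s, O s & z = s * t ^+ n.+1)) =>
  [||y z /m_gen[s Os ->] /IH[r Or ->]].
- by exists 0; rewrite ?mul0r //; apply/(pair_sub Om)/(pair0 Om).
- move=> _ _ [s Os ->] [r Or ->]; exists (s + r); rewrite ?mulrDl //.
  exact: (pairOD Om).
- by exists (s * r); [exact: (pairOM Om)|rewrite exprS mulrACA].
Qed.

(** An element of order [n] is [s * t ^+ n] with [s] outside [m], and primality of [m] keeps
    products of such [s] outside [m]. The premise, Krull's intersection property, excludes infinite
    order. *)
Lemma principal_additive_order :
  (forall x, O x -> (forall n, exists2 s, O s & x = s * t ^+ n) -> x = 0) ->
  additive_order O m.
Proof.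
move=> krull; split=> [x Ox x0|a b x y].
  pose P n := `[< ~ max_pow O m n x >].
  have exP : exists n, P n.
    apply: contrapT => /forallNP nP; move/eqP: x0; apply; apply: krull => // n.
    apply/max_pow_principal; apply: contrapT => nx.
    by apply: (nP n); apply/asboolP.
  have [n /asboolP nx n_min] := ex_minnP exP.
  case: n nx n_min => [|n] nx n_min; first by case: nx.
  exists n; split=> //; apply: contrapT => h.
  have /n_min : P n by apply/asboolP.
  by rewrite ltnn.
have unitE n z : has_order O m n z ->
    exists s, [/\ O s, ~ m s & z = s * t ^+ n].
  move=> [/max_pow_principal[s Os ->] nz]; exists s; split=> // ms.
  apply: nz; apply/max_pow_principal; have [r Or ->] := m_gen ms.
  by exists r; rewrite // -mulrA -exprS.
move=> hx hy; have x0 := has_order_neq0 Om hx; have y0 := has_order_neq0 Om hy.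
have [s [Os ns xE]] := unitE _ _ hx; have [r [Or nr yE]] := unitE _ _ hy.
have xyE : x * y = s * r * t ^+ (a + b) by rewrite exprD mulrACA -xE -yE.
split; first by apply/max_pow_principal; exists (s * r); rewrite // ; exact: (pairOM Om).
(* A larger order would put [s * r] into [m] after cancelling [t ^+ (a + b)], which is nonzero
   because [x * y] is. *)
move=> /max_pow_principal[u Ou]; rewrite xyE exprS mulrA => /mulIf sr.
have : m (s * r) by rewrite sr; [exact: (pairM Om)|
  apply: contraNneq (mulf_neq0 x0 y0) => t0; rewrite xyE t0 mulr0].
by case/(pair_prime Om).
Qed.

End Principal.

End Order.

(** * Local rings of the cones *)

Section LocalRing.
Variables (K : closedFieldType) (V : vectType K).
Implicit Types (X Y Z : projVariety V) (W : set V) (a b c d f g : Sym V) (v : V).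

Lemma coord_res_eq X f g :
  (coord_res X f == coord_res X g) = (f - g \in vanishing (cone X)).
Proof. by rewrite piE Quotient.equivE. Qed.

Lemma coord_res0 X : coord_res X 0 = 0.
Proof. exact: raddf0. Qed.

Lemma coord_res_eq0 X f : (coord_res X f == 0) = (f \in vanishing (cone X)).
Proof. by rewrite -(coord_res0 X) coord_res_eq subr0. Qed.

Lemma coord_resD X f g : coord_res X (f + g) = coord_res X f + coord_res X g.
Proof. exact: raddfD. Qed.

Lemma coord_resM X f g : coord_res X (f * g) = coord_res X f * coord_res X g.
Proof. exact: rmorphM. Qed.

Lemma coord_res1 X : coord_res X 1 = 1.
Proof. exact: rmorph1. Qed.

Lemma vanishing_sub W W' f : W `<=` W' -> f \in vanishing W' -> f \in vanishing W.
Proof. by move=> WW' /vanishingP h; apply/vanishingP => v /WW' /h. Qed.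

Lemma vanishing0 W : 0 \in vanishing W.
Proof. by apply/vanishingP => v _; apply: meval0. Qed.

Lemma vanishingD W f g :
  f \in vanishing W -> g \in vanishing W -> f + g \in vanishing W.
Proof.
move=> /vanishingP hf /vanishingP hg; apply/vanishingP => v Wv.
by rewrite evalSD hf // hg // addr0.
Qed.

Lemma vanishingM W f g : g \in vanishing W -> f * g \in vanishing W.
Proof.
by move=> /vanishingP hg; apply/vanishingP => v Wv; rewrite evalSM hg // mulr0.
Qed.

Lemma vanishing_eq W f g :
  f - g \in vanishing W -> (f \in vanishing W) = (g \in vanishing W).
Proof.
move=> /vanishingP fg.
by apply/vanishingP/vanishingP => h v Wv; have := fg v Wv; have := h v Wv;
  rewrite /evalS mevalB => -> /eqP; rewrite subr_eq0 => /eqP.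
Qed.

(** Primality of the vanishing ideal, isolated so that cones and the vertex [[set 0]] are treated
    alike. *)
Definition prime_vanishing W :=
  1 \notin vanishing W /\
  forall f g, (f * g \in vanishing W) = (f \in vanishing W) || (g \in vanishing W).

Lemma prime_vanishingX W f n :
  prime_vanishing W -> f \notin vanishing W -> f ^+ n \notin vanishing W.
Proof.
move=> [W1 WM] fW; elim: n => [|n IH] //.
by rewrite exprS WM negb_or fW.
Qed.

Lemma prime_vanishing_cone X : prime_vanishing (cone X).
Proof.
split; first by case: (@cone_ideal_closed _ _ X).
move=> f g; apply/idP/orP => [/cone_ideal_prime/orP|[]] //; last exact: vanishingM.
by rewrite mulrC; apply: vanishingM.
Qed.

Lemma prime_vanishing0 : prime_vanishing [set 0 : V].
Proof.
split=> [|f g].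
  apply/vanishingP => /(_ 0 erefl)/eqP.
  by rewrite /evalS meval1 oner_eq0.
apply/idP/orP => [/vanishingP/(_ 0 erefl)/eqP|[]]; last exact: vanishingM.
  rewrite evalSM mulf_eq0.
  by move=> /orP[]/eqP h; [left|right]; apply/vanishingP => _ ->.
by rewrite mulrC; apply: vanishingM.
Qed.

Section Fractions.
Variable X : projVariety V.

Lemma frac_eq0 f : ((coord_res X f)%:F == 0) = (f \in vanishing (cone X)).
Proof. by rewrite tofrac_eq0 coord_res_eq0. Qed.

Lemma frac_neq0 f : f \notin vanishing (cone X) -> (coord_res X f)%:F != 0.
Proof. by rewrite frac_eq0. Qed.

Lemma ratio_eq a b c d : b \notin vanishing (cone X) -> d \notin vanishing (cone X) ->
  (ratio_on X a b == ratio_on X c d) = (a * d - c * b \in vanishing (cone X)).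
Proof.
move=> /frac_neq0 b0 /frac_neq0 d0.
rewrite /ratio_on (eqr_div _ _ b0 d0) -!tofracM tofrac_eq -!coord_resM.
exact: coord_res_eq.
Qed.

Lemma ratio_eq0 a b : b \notin vanishing (cone X) ->
  (ratio_on X a b == 0) = (a \in vanishing (cone X)).
Proof.
move=> /frac_neq0 b0.
by rewrite /ratio_on mulf_eq0 invr_eq0 (negbTE b0) orbF frac_eq0.
Qed.

Lemma ratio1 f : ratio_on X f 1 = (coord_res X f)%:F.
Proof. by rewrite /ratio_on coord_res1 tofrac1 divr1. Qed.

Lemma ratioD a b c d : b \notin vanishing (cone X) -> d \notin vanishing (cone X) ->
  ratio_on X a b + ratio_on X c d = ratio_on X (a * d + c * b) (b * d).
Proof.
move=> /frac_neq0 b0 /frac_neq0 d0; rewrite /ratio_on (addf_div _ _ b0 d0).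
by rewrite coord_resD !coord_resM tofracD !tofracM.
Qed.

Lemma ratioM a b c d : ratio_on X a b * ratio_on X c d = ratio_on X (a * c) (b * d).
Proof. by rewrite /ratio_on mulf_div !coord_resM !tofracM. Qed.

Lemma ratio_sum b (I : Type) (r : seq I) (P : pred I) (E : I -> Sym V) :
  ratio_on X (\sum_(i <- r | P i) E i) b = \sum_(i <- r | P i) ratio_on X (E i) b.
Proof.
apply: (big_morph (fun a => ratio_on X a b)) => [a c|]; rewrite /ratio_on.
  by rewrite coord_resD tofracD mulrDl.
by rewrite coord_res0 tofrac0 mul0r.
Qed.

End Fractions.

(** Two representations of one fraction have a cross difference vanishing on the cone of [X], hence
    on that of [Y]; so the choice made by [restrict] does not matter. *)
Lemma restrict_ratio X Y a b : cone Y `<=` cone X -> b \notin vanishing (cone Y) ->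
  restrict Y (ratio_on X a b) = ratio_on Y a b.
Proof.
move=> YX bY; apply: xget_unique => [|_ [c [d [dY /eqP + ->]]]]; first by exists a, b.
have bX := contra (vanishing_sub YX) bY; have dX := contra (vanishing_sub YX) dY.
by rewrite (ratio_eq _ _ bX dX) => /(vanishing_sub YX); rewrite -(ratio_eq _ _ bY dY) => /eqP.
Qed.

Lemma restrict_res X Y f : cone Y `<=` cone X ->
  restrict Y (coord_res X f)%:F = (coord_res Y f)%:F.
Proof.
move=> YX; rewrite -!ratio1 restrict_ratio //.
by case: (prime_vanishing_cone Y).
Qed.

Section Along.
Variables (X : projVariety V) (W : set V).
Hypotheses (WX : W `<=` cone X) (W_prime : prime_vanishing W).
Local Notation O := (cone_loc X W).
Local Notation m := (cone_loc_max X W).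

Let WM b d : b \notin vanishing W -> d \notin vanishing W -> b * d \notin vanishing W.
Proof. by rewrite W_prime.2 negb_or => -> ->. Qed.

Let W_notin b : b \notin vanishing W -> b \notin vanishing (cone X).
Proof. by apply: contra; apply: vanishing_sub. Qed.

Lemma cone_loc_ratio a b : b \notin vanishing W -> O (ratio_on X a b).
Proof. by move=> bW; exists a, b. Qed.

Lemma cone_loc_res f : O (coord_res X f)%:F.
Proof. by rewrite -ratio1; apply: cone_loc_ratio; apply: W_prime.1. Qed.

(** By primality of the vanishing ideal of [W], membership in [m] can be tested on any
    representation with denominator not vanishing on [W]. *)
Lemma cone_loc_maxE a b : b \notin vanishing W ->
  m (ratio_on X a b) <-> a \in vanishing W.
Proof.
move=> bW; split=> [[c [d [cW dW /eqP]]]|aW]; last by exists a, b.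
rewrite ratio_eq ?W_notin // => /(vanishing_sub WX)/vanishing_eq.
by rewrite !W_prime.2 cW (negbTE dW) orbF.
Qed.

Lemma cone_loc_max_res f : m (coord_res X f)%:F <-> f \in vanishing W.
Proof. by rewrite -ratio1; apply: cone_loc_maxE; apply: W_prime.1. Qed.

Lemma cone_loc_prime : prime_pair O m.
Proof.
split.
- by rewrite -tofrac1 -(coord_res1 X); apply: cone_loc_res.
- move=> _ _ [a [b [bW ->]]] [c [d [dW ->]]].
  by rewrite ratioD ?W_notin //; apply: cone_loc_ratio; apply: WM.
- move=> _ _ [a [b [bW ->]]] [c [d [dW ->]]].
  by rewrite ratioM; apply: cone_loc_ratio; apply: WM.
- by move=> _ [a [b [aW bW ->]]]; apply: cone_loc_ratio.
- by rewrite -tofrac0 -(coord_res0 X); apply/cone_loc_max_res/vanishing0.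
- move=> _ _ [a [b [aW bW ->]]] [c [d [cW dW ->]]].
  rewrite ratioD ?W_notin //; apply/cone_loc_maxE; first exact: WM.
  by apply: vanishingD; rewrite mulrC; apply: vanishingM.
- move=> _ _ [a [b [bW ->]]] [c [d [cW dW ->]]].
  by rewrite ratioM; apply/cone_loc_maxE; [exact: WM|exact: vanishingM].
- rewrite -tofrac1 -(coord_res1 X) => /cone_loc_max_res; apply/negP.
  exact: W_prime.1.
- move=> _ _ [a [b [bW ->]]] [c [d [dW ->]]]; rewrite ratioM.
  move=> /cone_loc_maxE; rewrite WM // W_prime.2 => /(_ isT)/orP[]; [left|right];
    exact/cone_loc_maxE.
Qed.

End Along.

End LocalRing.

(** * The order at the vertex of a cone *)

Section LowCoefficients.
Variables (R : idomainType) (p q : {poly R}) (n k : nat).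
Hypotheses (p_low : forall i, (i < n)%N -> p`_i = 0)
           (q_low : forall i, (i < k)%N -> q`_i = 0).

Lemma coefM_low i : (i < n + k)%N -> (p * q)`_i = 0.
Proof.
move=> lt_i; rewrite coefM big1 // => -[j /= lt_j] _.
have [/p_low->|le_nj] := ltnP j n; first by rewrite mul0r.
by rewrite q_low ?mulr0 //; lia.
Qed.

Lemma coefM_lowest : (p * q)`_(n + k) = p`_n * q`_k.
Proof.
have lt_n : (n < (n + k).+1)%N by rewrite ltnS leq_addr.
rewrite coefM (bigD1 (Ordinal lt_n)) //= addKn big1 ?addr0 // => -[j /= lt_j].
rewrite -val_eqE /= => ne_jn.
have [/p_low->|le_nj] := ltnP j n; first by rewrite mul0r.
by rewrite q_low ?mulr0 //; lia.
Qed.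

End LowCoefficients.

Section Vertex.
Variables (K : closedFieldType) (V : vectType K).
Implicit Types (f g a b : Sym V) (v : V).

Lemma poly_horner_inj (p q : {poly K}) : (forall t, p.[t] = q.[t]) -> p = q.
Proof.
move=> pq; apply/eqP; rewrite -subr_eq0; apply/eqP/poly_eq0_horner => t.
by rewrite hornerD hornerN pq subrr.
Qed.

Lemma line_polyD f g v : line_poly (f + g) v = line_poly f v + line_poly g v.
Proof. by apply: poly_horner_inj => t; rewrite hornerD !line_polyE evalSD. Qed.

Lemma line_polyM f g v : line_poly (f * g) v = line_poly f v * line_poly g v.
Proof. by apply: poly_horner_inj => t; rewrite hornerM !line_polyE evalSM. Qed.

(** Along the line through [v], the powers of the parameter separate the homogeneous components of
    [f]; this reduces questions about degrees to polynomials in one variable. *)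
Lemma coef_line_poly f v d : (line_poly f v)`_d = evalS (pihomog mdeg d f) v.
Proof.
rewrite coef_poly; case: ltnP => // le_fd.
rewrite pihomogE big_seq_cond big_pred0 ?/evalS ?meval0 // => u.
apply/negP => /andP[/msize_mdeg_lt lt_u /eqP deg_u].
by move: lt_u; rewrite deg_u ltnNge le_fd.
Qed.

Lemma coef0_line_poly f v : (line_poly f v)`_0 = evalS f 0.
Proof. by rewrite -horner_coef0 line_polyE scale0r. Qed.

Variable X : projVariety V.

Lemma coneZ t v : cone X v -> cone X (t *: v).
Proof.
move=> [->|[L XL vL]]; first by left; rewrite scaler0.
by right; exists L; rewrite ?memvZ.
Qed.

Lemma cone0 : [set 0] `<=` cone X.
Proof. by move=> _ ->; left. Qed.

Lemma line_poly_vanishing f v : f \in vanishing (cone X) -> cone X v ->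
  line_poly f v = 0.
Proof.
move=> /vanishingP fX Xv; apply: poly_eq0_horner => t.
by rewrite line_polyE fX //; apply: coneZ.
Qed.

(** The ideal of a cone is homogeneous, since the cone contains the line through each of its
    points. *)
Lemma vanishing_pihomog f d :
  f \in vanishing (cone X) -> pihomog mdeg d f \in vanishing (cone X).
Proof.
move=> fX; apply/vanishingP => v Xv.
by rewrite -coef_line_poly line_poly_vanishing ?coef0.
Qed.

(** By [coef_line_poly], this says that the components of [f] of degree below [n] vanish on the
    cone. *)
Definition low n f := forall v, cone X v -> forall i, (i < n)%N -> (line_poly f v)`_i = 0.

Lemma lowM n k f g : low n f -> low k g -> low (n + k) (f * g).
Proof.
move=> nf kg v Xv i lt_i; rewrite line_polyM (coefM_low (n := n) (k := k)) //.
  exact: nf.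
exact: kg.
Qed.

Lemma lowMr n f g : low n f -> low n (f * g).
Proof. by move=> nf; rewrite -[n]addn0; apply: lowM. Qed.

Lemma lowD n f g : low n f -> low n g -> low n (f + g).
Proof.
by move=> nf ng v Xv i lt_i; rewrite line_polyD coefD nf ?ng ?addr0.
Qed.

Lemma low_homog n d f : f \is d.-homog -> (n <= d)%N -> low n f.
Proof.
move=> fd le_nd v Xv i lt_i; rewrite coef_line_poly.
have ne_di : d != i by rewrite neq_ltn (leq_trans lt_i le_nd) orbT.
by rewrite (pihomog_ne0 ne_di fd) /evalS meval0.
Qed.

Lemma low1 f : f \in vanishing [set 0] -> low 1 f.
Proof. by move=> /vanishingP f0 v Xv [|//] _; rewrite coef0_line_poly f0. Qed.

Lemma low_part f n : low n f ->
  exists2 g, f - g \in vanishing (cone X) & forall u, u \in msupp g -> (n <= mdeg u)%N.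
Proof.
move=> nf; exists (\sum_(d < msize f | (n <= d)%N) pihomog mdeg d f).
  apply/vanishingP => v Xv.
  rewrite {1}(pihomog_partitionE (mf := mdeg) (leqnn (msize f))).
  rewrite (bigID (fun d : 'I__ => (n <= d)%N)) /= addrAC subrr add0r /evalS raddf_sum.
  apply: big1 => d; rewrite -ltnNge => lt_d /=.
  by have := nf v Xv d lt_d; rewrite coef_line_poly.
move=> u; rewrite mcoeff_msupp; apply: contraR; rewrite -ltnNge => lt_u.
rewrite raddf_sum big1 //= => d le_d.
by rewrite (dhomog_nemf_coeff (pihomogP _ _ _)) // neq_ltn (leq_trans lt_u le_d).
Qed.

Local Notation O := (cone_loc X [set 0]).
Local Notation m := (cone_loc_max X [set 0]).

Lemma vertex_prime : prime_pair O m.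
Proof. exact: cone_loc_prime cone0 (prime_vanishing0 V). Qed.

(** Each factor from [m] is a variable split off the monomial; variables vanish at the vertex. *)
Lemma max_pow_monomial n b c u : b \notin vanishing [set 0] -> (n <= mdeg u)%N ->
  max_pow O m n (ratio_on X (c *: 'X_[u]) b).
Proof.
move=> b0; elim: n u => [|n IH] u le_u; first exact: cone_loc_ratio.
have [i ui] : exists i, (0 < u i)%N.
  apply/existsP; apply: contraTT le_u; rewrite negb_exists => /forallP u0.
  rewrite mdegE big1 // => i _; apply/eqP; by rewrite -leqn0 leqNgt.
have uE : u = (U_(i) + (u - U_(i)))%MM.
  by rewrite addmC submK //; apply/mnm_lepP => j; rewrite mnm1E; case: eqP => [<-|].
rewrite uE mpolyXD scalerAr -[b]mul1r -ratioM; apply: max_powS.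
  apply/(cone_loc_maxE cone0 (prime_vanishing0 V)); first exact: (prime_vanishing0 V).1.
  by apply/vanishingP => _ ->; rewrite /evalS mevalXU linear0.
by apply: IH; move: le_u; rewrite {1}uE mdegD mdeg1.
Qed.

(** A numerator vanishing at 0 has [low 1], and [low] adds up under products. Conversely, modulo the
    ideal of the cone a numerator with [low n] is a combination of monomials of degree at least
    [n]. *)
Lemma max_pow_vertex n x : max_pow O m n x <->
  exists a b, [/\ b \notin vanishing [set 0], low n a & x = ratio_on X a b].
Proof.
split.
  elim: n x => [x [a [b [b0 ->]]]|n IH x]; first by exists a, b.
  apply: (max_powS_ind (P := fun x => exists a b, [/\ b \notin vanishing [set 0],
    low n.+1 a & x = ratio_on X a b])).
  - exists 0, 1; split; first exact: (prime_vanishing0 V).1.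
      by apply: (low_homog (d := n.+1)); rewrite ?rpred0.
    by apply/esym/eqP; rewrite ratio_eq0 ?vanishing0 //; exact: (prime_vanishing_cone X).1.
  - move=> _ _ [a [b [b0 na ->]]] [c [d [d0 nc ->]]].
    have bX := contra (vanishing_sub cone0) b0; have dX := contra (vanishing_sub cone0) d0.
    exists (a * d + c * b), (b * d); rewrite ratioD //; split=> //.
      by rewrite (prime_vanishing0 V).2 negb_or b0.
    by apply: lowD; apply: lowMr.
  - move=> _ _ [a [b [a0 b0 ->]]] /IH[c [d [d0 nc ->]]].
    exists (a * c), (b * d); rewrite ratioM; split=> //.
      by rewrite (prime_vanishing0 V).2 negb_or b0.
    by rewrite -add1n; apply: lowM => //; apply: low1.
move=> [a [b [b0 /low_part[g ag ng] ->]]].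
have bX := contra (vanishing_sub cone0) b0.
have -> : ratio_on X a b = ratio_on X g b.
  by apply/eqP; rewrite ratio_eq // -mulrBl mulrC vanishingM.
have -> : ratio_on X g b = \sum_(u <- msupp g) ratio_on X (g@_u *: 'X_[u]) b.
  by rewrite {1}[g]mpolyE ratio_sum.
rewrite big_seq; apply: big_ind => [||u /ng]; [exact: (max_pow0 vertex_prime)|
  exact: (max_powD vertex_prime)|exact: max_pow_monomial].
Qed.

Lemma has_order_vertex n a b : b \notin vanishing [set 0] -> low n a ->
  has_order O m n (ratio_on X a b) <-> pihomog mdeg n a \notin vanishing (cone X).
Proof.
move=> b0 na; split=> [[_ nx]|/negP an].
  apply/negP => /vanishingP an; apply: nx; apply/max_pow_vertex.
  exists a, b; split=> // v Xv i; rewrite ltnS leq_eqVlt => /orP[/eqP->|]; last exact: na.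
  by rewrite coef_line_poly an.
split; first by apply/max_pow_vertex; exists a, b.
move=> /max_pow_vertex[c [d [d0 nc /eqP]]].
have bX := contra (vanishing_sub cone0) b0; have dX := contra (vanishing_sub cone0) d0.
rewrite ratio_eq // => adcb; apply: an; apply/vanishingP => v Xv.
have : line_poly (a * d) v = line_poly (c * b) v.
  apply/eqP; rewrite -subr_eq0; apply/eqP.
  rewrite -(line_poly_vanishing adcb Xv); apply: poly_horner_inj => t.
  by rewrite hornerD hornerN !line_polyE /evalS mevalB.
(* In degree [n] the right side is zero, and the left side is the degree [n] component of [a] at [v]
   times [d(0)], which is nonzero. *)
move=> /(congr1 (fun p : {poly K} => p`_n)).
rewrite (lowMr b nc Xv (ltnSn n)) line_polyM -{1}[n]addn0.
rewrite (coefM_lowest (na v Xv) (k := 0)) // coef0_line_poly => /eqP.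
rewrite mulf_eq0 => /orP[/eqP<-|].
  by rewrite coef_line_poly.
move=> /eqP dv; case/vanishingP: d0; by move=> _ ->.
Qed.

(** The order is the least degree whose component does not vanish on the cone. The lowest component
    of a product is the product of the lowest components, and it survives because the ideal of the
    cone is prime. *)
Lemma vertex_additive_order : additive_order O m.
Proof.
split=> [_ [a [b [b0 ->]]]|i j x y].
  have bX := contra (vanishing_sub cone0) b0; rewrite ratio_eq0 // => aX.
  pose P n := `[< exists v, cone X v /\ (line_poly a v)`_n != 0 >].
  have exP : exists n, P n.
    apply: contrapT => /forallNP nP; case/vanishingP: aX => v Xv.
    rewrite -[v]scale1r -line_polyE; suff -> : line_poly a v = 0 by rewrite horner0.
    apply/polyP => n; rewrite coef0; apply/eqP/negPn/negP => av.
    by apply: (nP n); apply/asboolP; exists v.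
  have [n /asboolP[v [Xv av]] n_min] := ex_minnP exP.
  exists n; apply/has_order_vertex => // [w Xw i lt_i|].
    apply/eqP/negPn/negP => aw; have : P i by apply/asboolP; exists w.
    by move/n_min; rewrite leqNgt lt_i.
  by apply: contra av => /vanishingP an; rewrite coef_line_poly an.
move=> hx hy; have [/max_pow_vertex[a [b [b0 ia xE]]] _] := hx.
have [/max_pow_vertex[c [d [d0 jc yE]]] _] := hy.
move: hx hy; rewrite xE yE ratioM => /has_order_vertex-/(_ b0 ia) ai.
move=> /has_order_vertex-/(_ d0 jc) cj.
apply/has_order_vertex; [|exact: lowM|].
  by rewrite (prime_vanishing0 V).2 negb_or b0.
apply/negP => /vanishingP ac.
have : pihomog mdeg i a * pihomog mdeg j c \in vanishing (cone X).
  apply/vanishingP => v Xv; rewrite evalSM -!coef_line_poly -coefM_lowest.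
  - by rewrite -line_polyM coef_line_poly ac.
  - exact: ia.
  - exact: jc.
by rewrite (prime_vanishing_cone X).2 (negbTE ai) (negbTE cj).
Qed.

Lemma has_order_vertex_homog d f : f \is d.-homog -> f \notin vanishing (cone X) ->
  has_order O m d (coord_res X f)%:F.
Proof.
move=> fd fX; rewrite -ratio1; apply/has_order_vertex.
- exact: (prime_vanishing0 V).1.
- exact: low_homog fd _.
- by rewrite pihomog_dE.
Qed.

End Vertex.

(** * The order along a subvariety of codimension one *)

Section Covering.
Variables (K : closedFieldType) (V : vectType K) (X Z : projVariety V).
Hypothesis ZX : pts Z `<=` pts X.
Local Notation O := (cone_loc X (cone Z)).
Local Notation m := (cone_loc_max X (cone Z)).

Lemma cone_sub : cone Z `<=` cone X.
Proof. by move=> v [->|[L /ZX XL vL]]; [left|right; exists L]. Qed.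

Let Om : prime_pair O m := cone_loc_prime cone_sub (prime_vanishing_cone Z).

Let notinX b : b \notin vanishing (cone Z) -> b \notin vanishing (cone X).
Proof. by apply: contra; apply: vanishing_sub cone_sub. Qed.

(* Krull's intersection theorem: if x = s_n t^n for all n, then noetherianity
   makes some s_n a combination of the s_i = s_n t^(n-i), i < n, so s_n lies in
   t s_n O. *)
Lemma cone_loc_krull t x : m t ->
  (forall n, exists2 s, O s & x = s * t ^+ n) -> x = 0.
Proof.
move=> mt xt; apply/eqP/negPn/negP => x0.
have /choice[ab abP] : forall n, exists ab : Sym V * Sym V,
    ab.2 \notin vanishing (cone Z) /\ x = ratio_on X ab.1 ab.2 * t ^+ n.
  by move=> n; have [_ [a [b [bZ ->]]] ->] := xt n; exists (a, b).
pose s n := ratio_on X (ab n).1 (ab n).2.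
have xs n : x = s n * t ^+ n by case: (abP n).
have bZ n : (ab n).2 \notin vanishing (cone Z) by case: (abP n).
have s0 n : s n != 0 by apply: contraNneq x0 => sn; rewrite (xs n) sn mul0r.
have tX n : t ^+ n != 0 by apply: contraNneq x0 => tn; rewrite (xs n) tn mulr0.
have sE i n : (i <= n)%N -> s i = s n * t ^+ (n - i).
  by move=> le_in; apply: (mulIf (tX i)); rewrite -(mulrA (s n)) -exprD subnK // -xs -xs.
have [n [c an]] := noetherian_mpoly (fun n => (ab n).1).
have [r Or sr] : exists2 r, O r & s n = r * (t * s n).
  rewrite {1}/s an ratio_sum; apply: (sum_multiple Om) => i _.
  exists (ratio_on X (c i * (ab i).2) (ab n).2 * t ^+ (n - i).-1).
    apply: (pairOM Om); first exact: cone_loc_ratio.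
    elim: (_.-1) => [|k IH]; first exact: (pairO1 Om).
    by rewrite exprS; apply: (pairOM Om) => //; apply: (pair_sub Om).
  have tE : t ^+ (n - i).-1 * (t * s n) = s i.
    by rewrite mulrA -exprSr prednK ?subn_gt0 // mulrC -(sE _ _ (ltnW (ltn_ord i))).
  rewrite -(mulrA (ratio_on X _ _)) tE /s ratioM; apply/eqP.
  have bi := notinX (bZ i); have bn := notinX (bZ n).
  have bni : (ab n).2 * (ab i).2 \notin vanishing (cone X).
    by rewrite (prime_vanishing_cone X).2 negb_or bn.
  rewrite (ratio_eq _ _ bn bni).
  suff -> : c i * (ab i).1 * ((ab n).2 * (ab i).2) -
    c i * (ab i).2 * (ab i).1 * (ab n).2 = 0 by apply: vanishing0.
  by apply/eqP; rewrite subr_eq0; apply/eqP; ring.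
apply: (pair1 Om); suff -> : 1 = r * t by apply: (pairM Om).
(* Cancelling the nonzero [s n] leaves [1 = r * t], which would lie in [m]. *)
by apply: (mulIf (s0 n)); rewrite mul1r -mulrA -sr.
Qed.

(** A point of [Z] has a nonzero vector and so a nonzero coordinate. Powers of this coordinate serve
    as denominators that bring forms to degree 0. *)
Lemma variety_coord : exists i, ('X_i : Sym V) \notin vanishing (cone Z).
Proof.
have [L ZL] := (pts_irreducible Z).1; have [v vL v0] := pt_vector L.
apply: contrapT => /forallNP nX; move/eqP: v0; apply.
rewrite (coord_vbasis (memvf v)) big1 // => i _.
have /negP/negPn/vanishingP/(_ v) := nX i; rewrite /evalS mevalXU => -> //.
  by rewrite scale0r.
by right; exists L.
Qed.

Lemma proj_loc_sub : proj_loc X Z `<=` O.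
Proof. by move=> _ [d [a [b [_ _ bZ ->]]]]; apply: cone_loc_ratio. Qed.

(** The generator [t] of the maximal ideal of the projective local ring also generates [m], so the
    principal case applies together with Krull's intersection theorem. *)
Lemma regular_additive_order :
  regular_of_dim (proj_loc X Z) (proj_loc_max X Z) 1 -> additive_order O m.
Proof.
move=> [t [mt t_gen]]; have m_t : m (t ord0).
  by have [d [a [b [_ _ aZ bZ ->]]]] := mt ord0; exists a, b.
apply: (principal_additive_order Om m_t); last first.
  by move=> x _; apply: cone_loc_krull.
move=> _ [a [b [aZ bZ ->]]]; have [i Xi] := variety_coord.
rewrite (pihomog_partitionE (mf := mdeg) (leqnn (msize a))) ratio_sum.
apply: (sum_multiple Om) => d _.
have Xd := prime_vanishingX d (prime_vanishing_cone Z) Xi.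
(* Dividing the degree [d] component of [a] by ['X_i ^+ d] gives a fraction of degree 0 vanishing
   along [Z], to which regularity applies; the power of ['X_i] is a unit of [O]. *)
have [c [Oc cE]] : exists c, proj_loc X Z c /\
    ratio_on X (pihomog mdeg d a) ('X_i ^+ d) = c * t ord0.
  have [|c [Oc ->]] := t_gen (ratio_on X (pihomog mdeg d a) ('X_i ^+ d)).
    exists d, (pihomog mdeg d a), ('X_i ^+ d); split=> //.
    - exact: pihomogP.
    - by rewrite -[X in X.-homog]mul1n dhomogMn // dhomogX; apply/eqP/mdeg1.
    - exact: vanishing_pihomog.
  by exists (c ord0); rewrite big_ord1.
exists (ratio_on X ('X_i ^+ d) b * c).
  by apply: (pairOM Om); [exact: cone_loc_ratio|exact: proj_loc_sub].
rewrite -mulrA -cE ratioM; apply/eqP.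
have bXd : b * 'X_i ^+ d \notin vanishing (cone Z).
  by rewrite (prime_vanishing_cone Z).2 negb_or bZ.
rewrite (ratio_eq _ _ (notinX bZ) (notinX bXd)).
suff -> : pihomog mdeg d a * (b * 'X_i ^+ d) - 'X_i ^+ d * pihomog mdeg d a * b = 0.
  exact: vanishing0.
by apply/eqP; rewrite subr_eq0; apply/eqP; ring.
Qed.

End Covering.

(** * Bonds and chains *)

Section Chains.
Variables (K : closedFieldType) (V : vectType K) (X : projVariety V).
Variables (disp : Order.disp_t) (A : finPOrderType disp) (S : seshadri X A).
Implicit Types (p q x y z : A) (C D : seq A) (f g : Sym V).

Local Notation van p := (vanishing (cone (S p))).
Local Notation res p f := (coord_res (S p) f)%:F.
Local Notation N := (bond_lcm S).

(** Otherwise all equations of the closed set [Z] would vanish on [Y]. *)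
Lemma closed_separation (Y Z : projVariety V) : ~ (pts Y `<=` pts Z) ->
  exists2 g, g \in vanishing (cone Z) & g \notin vanishing (cone Y).
Proof.
move=> YZ; apply: contrapT => sep; apply: YZ => L YL.
have [T _ ZE] := pts_closed Z; rewrite ZE => f Tf v vL.
have fZ : f \in vanishing (cone Z).
  by apply/coneP => L'; rewrite ZE => h; apply: h.
have fY : f \in vanishing (cone Y) by apply/negPn/negP => fY; apply: sep; exists f.
exact: (elimT (coneP _ _) fY) L YL v vL.
Qed.

Lemma strat_mono p q : (q <= p)%O -> pts (S q) `<=` pts (S p).
Proof. by move/strat_le. Qed.

Lemma covered_lt p q : covered_by q p -> (q < p)%O.
Proof. by case/andP. Qed.

Lemma extremal_vanishing p q : covered_by q p -> extremal S p \in van q.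
Proof.
move=> qp; apply/coneP => L qL v vL.
have : (\bigcup_(z in [set z | covered_by z p]) pts (S z)) L by exists q.
by rewrite -S3 => -[h _]; apply: h.
Qed.

(* If f_p vanished on X_p, then X_p would be the union of the X_q with q
   covered by p, and the product of forms g_q separating X_p from the X_q
   would vanish on X_p. *)
Lemma extremal_nonvanishing p : extremal S p \notin van p.
Proof.
apply/negP => /coneP fp.
have /choice[g gP] : forall q, exists g, covered_by q p -> g \in van q /\ g \notin van p.
  move=> q; have [qp|] := boolP (covered_by q p); last by exists 0.
  have [|g gq gp] := @closed_separation (S p) (S q); last by exists g.
  by move/strat_le/(lt_le_trans (covered_lt qp)); rewrite ltxx.
have : \prod_(q | covered_by q p) g q \notin van p.
  apply: (big_ind (fun h => h \notin van p)) => [|a b ap bp|q /gP[]//].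
    by case: (prime_vanishing_cone (S p)).
  by rewrite (prime_vanishing_cone (S p)).2 negb_or ap.
case/coneP => L pL v vL.
have [q qp qL] : (\bigcup_(z in [set z | covered_by z p]) pts (S z)) L.
  by rewrite -S3; split=> // f -> w wL; apply: fp pL _ wL.
rewrite (bigD1 q) //= evalSM; have [/coneP gq _] := gP q qp.
by rewrite (gq L) // mul0r.
Qed.

Lemma extremal_nonvanishing_le p q : (q <= p)%O -> extremal S q \notin van p.
Proof.
move=> qp; apply: contra (extremal_nonvanishing q); apply: vanishing_sub.
exact/cone_sub/strat_mono.
Qed.

Lemma resX p f n : res p (f ^+ n) = res p f ^+ n.
Proof.
elim: n => [|n IH]; first by rewrite !expr0 coord_res1 tofrac1.
by rewrite !exprS coord_resM tofracM IH.
Qed.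

(** * Vanishing orders along coverings and at the vertex, and the bonds *)

Section ExtCover.
Variables (p : A) (o : option A).
Hypothesis op : ext_covered_by o p.
Local Notation O := (cone_loc (S p) (ext_cone S o)).
Local Notation m := (cone_loc_max (S p) (ext_cone S o)).

Lemma ext_cone_sub : ext_cone S o `<=` cone (S p).
Proof.
case: o op => [q /covered_lt/ltW/strat_mono|_]; first exact: cone_sub.
exact: cone0.
Qed.

Lemma ext_cone_prime : prime_vanishing (ext_cone S o).
Proof. by case: o => [q|]; [exact: prime_vanishing_cone|exact: prime_vanishing0]. Qed.

Lemma ext_prime_pair : prime_pair O m.
Proof. exact: cone_loc_prime ext_cone_sub ext_cone_prime. Qed.

(** Along a covering, (S1) supplies codimension one and regularity; below a minimal element the
    graded argument at the vertex takes over. *)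
Lemma ext_additive_order : additive_order O m.
Proof.
case: o op => [q qp|_]; last exact: vertex_additive_order.
apply: regular_additive_order; first exact/strat_mono/ltW/covered_lt.
exact/S1_smooth/S1_codim.
Qed.

Lemma res_order f : f \notin van p -> exists n, has_order O m n (res p f).
Proof.
move=> fp; apply: ext_additive_order.1; last exact: frac_neq0.
exact: cone_loc_res ext_cone_prime _.
Qed.

Lemma nu_order n f : has_order O m n (res p f) -> nu o (res p f) = n%:Z.
Proof. exact: (valuationE ext_prime_pair ext_additive_order). Qed.

Lemma res_orderX n k f :
  has_order O m n (res p f) -> has_order O m (k * n) (res p (f ^+ k)).
Proof.
by rewrite resX; apply: (has_orderX ext_prime_pair ext_additive_order).
Qed.

Lemma nu_unit f : f \notin vanishing (ext_cone S o) -> nu o (res p f) = 0.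
Proof.
move=> fo; apply: nu_order; apply: (has_order0 ext_prime_pair).
  exact: cone_loc_res ext_cone_prime _.
by move=> /(cone_loc_max_res ext_cone_sub ext_cone_prime); apply/negP.
Qed.

Lemma nu_vanishing f k : f \notin van p -> f \in vanishing (ext_cone S o) ->
  (0 < k)%N -> 0 < nu o (res p (f ^+ k)).
Proof.
move=> fp fo k0; have [n hn] := res_order fp.
rewrite (nu_order (res_orderX k hn)) ltz_nat muln_gt0 k0 /=.
apply: (has_order_gt0 ext_prime_pair hn).
exact/(cone_loc_max_res ext_cone_sub ext_cone_prime).
Qed.

End ExtCover.

(** For [None] the bond is defined as a degree; it agrees with the order at the vertex because
    [extremal S p] is homogeneous and nonzero on the cone. *)
Lemma bond_order p o : ext_covered_by o p ->
  (0 < bond S p o)%N /\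
  has_order (cone_loc (S p) (ext_cone S o)) (cone_loc_max (S p) (ext_cone S o))
    (bond S p o) (res p (extremal S p)).
Proof.
have fp := extremal_nonvanishing p; case: o => [q|] op.
  have [n hn] := res_order op fp.
  rewrite /bond /extremal_on (nu_order op hn) absz_nat; split=> //.
  have := nu_vanishing op fp (extremal_vanishing op) (ltn0Sn 0).
  by rewrite expr1 (nu_order op hn).
have [d d0 fd] := extremal_homog S p.
have f0 : extremal S p != 0 by apply: contraNneq fp => ->; exact: vanishing0.
have -> : bond S p None = d by exact: dhomog_uniq f0 (dhomog_msize fd) fd.
by split=> //; exact: has_order_vertex_homog.
Qed.

Lemma nu_extremalX p o k : ext_covered_by o p ->
  nu o (res p (extremal S p ^+ k)) = (k * bond S p o)%N%:Z.
Proof. by move=> op; apply/(nu_order op)/(res_orderX op); case: (bond_order op). Qed.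

Lemma bond_gt0 p o : ext_covered_by o p -> (0 < bond S p o)%N.
Proof. by case/bond_order. Qed.

Lemma bond_lcm_gt0 : (0 < N)%N.
Proof.
rewrite /bond_lcm; elim/big_ind: _ => [//|a b a0 b0|p _]; first by rewrite lcmn_gt0 a0.
elim/big_ind: _ => [//|a b a0 b0|o]; first by rewrite lcmn_gt0 a0.
exact: bond_gt0.
Qed.

(** * Powers of an extremal function followed down a chain *)

Lemma chain_step_unit p q f : covered_by q p -> f \notin van q ->
  chain_step q (res p f) = res q (f ^+ N).
Proof.
move=> qp fq; rewrite /chain_step (@nu_unit p (Some q) qp _ fq).
rewrite mulr0 div0z expr0z invr1 mulr1 -resX restrict_res //.
exact/cone_sub/strat_mono/ltW/covered_lt.
Qed.

(** Here [nu] is [k] times the bond, so the exponent in the denominator is exactly [N * k] and the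
    quotient is 1. *)
Lemma chain_step_extremal p q k : covered_by q p ->
  chain_step q (res p (extremal S p ^+ k)) = res q 1.
Proof.
move=> qp; rewrite /chain_step (nu_extremalX (o := Some q) _ qp).
have b0 : (bond S p (Some q))%:Z != 0.
  by have := bond_gt0 (o := Some q) qp; rewrite lt0n.
rewrite PoszM mulrA mulzK // -PoszM -exprnP -resX -exprM mulnC resX divff.
  rewrite -tofrac1 -(coord_res1 (S p)) restrict_res //.
  exact/cone_sub/strat_mono/ltW/covered_lt.
exact/expf_neq0/frac_neq0/extremal_nonvanishing.
Qed.

(** Maximal chains in the shape of the recursion of [chain_sum]: each step is a covering, and the
    last element is minimal. *)
Fixpoint cover_chain p C : bool :=
  if C is q :: C' then covered_by q p && cover_chain q C' else ext_covered_by None p.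

Lemma cover_chain_le p C x : cover_chain p C -> x \in p :: C -> (x <= p)%O.
Proof.
elim: C p => [|q C IH] p /=; first by rewrite inE => _ /eqP->.
move=> /andP[/covered_lt/ltW qp qC]; rewrite inE => /orP[/eqP-> //|xC].
exact: le_trans (IH _ qC xC) qp.
Qed.

(** Names the local [term] of [chain_sum], so that its two unfolding equations can be used for
    rewriting. *)
Definition chain_term c p o (h : fun_field (S p)) : {ffun A -> rat} :=
  [ffun x => c * ((nu o h)%:~R / (bond S p o)%:R) * indic p x].

Lemma chain_sum_nil c p (h : fun_field (S p)) :
  chain_sum c [::] h = chain_term c None h.
Proof. by []. Qed.

Lemma chain_sum_cons c p q C (h : fun_field (S p)) : chain_sum c (q :: C) h =
  chain_term c (Some q) h + chain_sum (c / N%:R) C (chain_step q h).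
Proof. by []. Qed.

Lemma chain_term_unit c p o f : ext_covered_by o p ->
  f \notin vanishing (ext_cone S o) -> chain_term c o (res p f) = 0.
Proof.
by move=> op fo; apply/ffunP => x; rewrite !ffunE nu_unit // mul0r mulr0 mul0r.
Qed.

Lemma chain_term_extremal c p o k : ext_covered_by o p -> c * k%:R = 1 ->
  chain_term c o (res p (extremal S p ^+ k)) = indic p.
Proof.
move=> op ck; apply/ffunP => x; rewrite ffunE nu_extremalX // PoszM rmorphM /=.
by rewrite mulfK ?ck ?mul1r // pnatr_eq0 -lt0n bond_gt0.
Qed.

Lemma chain_sum_support c p C (h : fun_field (S p)) x :
  chain_sum c C h x != 0 -> x \in p :: C.
Proof.
elim: C c p h => [|q C IH] c p h /=; rewrite !ffunE inE.
  by apply: contraR => /negbTE->; rewrite mulr0.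
apply: contraR; rewrite negb_or => /andP[/negbTE-> xC].
by rewrite mulr0 add0r; apply: contraR xC; exact: IH.
Qed.

Lemma chain_sum_one c p C : cover_chain p C -> chain_sum c C (res p 1) = 0.
Proof.
elim: C c p => [|q C IH] c p.
  by move=> p0; rewrite chain_sum_nil chain_term_unit //; case: (prime_vanishing0 V).
move=> /andP[qp qC]; have one_q : 1 \notin van q by case: (prime_vanishing_cone (S q)).
rewrite chain_sum_cons chain_step_unit // expr1n IH // addr0.
exact: (chain_term_unit _ (o := Some q)).
Qed.

(** The invariant [c * k%:R = 1] balances the weight against the exponent: above [q] each step
    divides [c] by [N] and multiplies [k] by [N]. At [q] the term is then [indic q], and the
    constant 1 below adds nothing. *)
Lemma chain_sum_through c p C q k : cover_chain p C -> q \in p :: C ->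
  c * k%:R = 1 -> chain_sum c C (res p (extremal S q ^+ k)) = indic q.
Proof.
elim: C c p k => [|z C IH] c p k.
  by move=> p0; rewrite inE => /eqP->; rewrite chain_sum_nil; apply: chain_term_extremal.
move=> /andP[zp zC]; rewrite inE chain_sum_cons.
have [qp _ ck|ne_qp /= qC ck] := eqVneq q p.
  rewrite qp chain_step_extremal // chain_sum_one // addr0.
  exact: (chain_term_extremal (o := Some z)).
have qz := cover_chain_le zC qC.
have fz := prime_vanishingX k (prime_vanishing_cone (S z)) (extremal_nonvanishing_le qz).
rewrite chain_step_unit // -exprM IH //; last first.
  rewrite natrM mulrACA ck mul1r mulVf // pnatr_eq0 -lt0n; exact: bond_lcm_gt0.
by rewrite (chain_term_unit _ (o := Some z)) // add0r.
Qed.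

(** The witness is the last element of the chain that is still above [q]; all earlier terms
    vanish. *)
Lemma chain_sum_off c p C q k : cover_chain p C -> (q <= p)%O -> q \notin p :: C ->
    0 < c -> (0 < k)%N ->
  exists2 z, (q < z)%O & 0 < chain_sum c C (res p (extremal S q ^+ k)) z /\
    forall x, chain_sum c C (res p (extremal S q ^+ k)) x != 0 -> (x <= z)%O.
Proof.
elim: C c p k => [|z C IH] c p k pC qp qC c0 k0.
  (* An empty tail makes [p] minimal, so [q <= p] forces [q = p], which is excluded. *)
  have /forallP/(_ q) : ext_covered_by None p := pC.
  by rewrite lt_neqAle qp andbT negbK; move: qC; rewrite inE => /negbTE->.
have /andP[zp zC] := pC; move: qC; rewrite inE negb_or => /andP[ne_qp qC].
have [qz|qz] := boolP (q <= z)%O.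
  have fz := prime_vanishingX k (prime_vanishing_cone (S z)) (extremal_nonvanishing_le qz).
  rewrite chain_sum_cons chain_step_unit // -exprM.
  rewrite (chain_term_unit _ (o := Some z)) // add0r.
  apply: IH => //; last by rewrite muln_gt0 k0 bond_lcm_gt0.
  by rewrite divr_gt0 // ltr0n bond_lcm_gt0.
exists p; first by rewrite lt_neqAle ne_qp.
split=> [|x /chain_sum_support]; last exact: cover_chain_le.
have pzC : p \notin z :: C.
  by apply/negP => /(cover_chain_le zC)/(lt_le_trans (covered_lt zp)); rewrite ltxx.
rewrite chain_sum_cons !ffunE eqxx mulr1.
(* The later terms live on elements strictly below [p], so only the first one counts at [p]; it is
   positive by (S2). *)
set h := chain_step _ _; have -> : chain_sum (c / N%:R) C h p = 0.
  by apply/eqP; apply: contraNT pzC; apply: chain_sum_support.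
rewrite addr0 pmulr_rgt0 // divr_gt0 ?ltr0n ?bond_gt0 // ltr0z.
apply: (nu_vanishing (o := Some z)) => //; first exact: extremal_nonvanishing_le.
by apply/coneP => L zL v vL; apply: (S2 qz zL).
Qed.

(** * Maximal chains of the poset *)

(** The axiom only makes [p_max S] the unique maximal element. By finiteness some [y] above [x] has
    a down-set of largest size; such a [y] is maximal. *)
Lemma le_p_max x : (x <= p_max S)%O.
Proof.
pose down y := [set w | (w <= y)%O]%SET.
have [y xy y_max] := arg_maxnP (P := fun y => (x <= y)%O) (fun y => #|down y|) (lexx x).
suff <- : y = p_max S by [].
apply/p_max_unique => w yw; apply/eqP; rewrite eq_le yw andbT.
have sub : down y \subset down w.
  by apply/fintype.subsetP => u; rewrite !inE => /le_trans; apply.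
have /eqP E : down y == down w.
  by rewrite eqEcard sub; apply: y_max; apply: le_trans xy yw.
have : w \in down y by rewrite E inE lexx.
by rewrite inE.
Qed.

Lemma maximal_chainP C : maximal_chain C ->
  pairwise >%O C /\ forall z, (forall x, x \in C -> (x >=< z)%O) -> z \in C.
Proof.
move=> [C_sorted /maxsetP[C_chain C_max]].
have tr : transitive (>%O : rel A) by move=> y x z xy yz; apply: lt_trans yz xy.
split=> [|z zC]; first by rewrite -sorted_pairwise.
have -> : (z \in C) = (z \in [set:: C]%SET) by rewrite inE.
rewrite -(C_max (z |: [set:: C])%SET) ?finset.setU11 ?finset.subsetUr //.
apply/forall_inP => x xC; apply/forall_inP => y yC; move: xC yC.
rewrite !inE => /orP[/eqP->|xC] /orP[/eqP->|yC].
- exact: comparablexx.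
- by rewrite comparable_sym; apply: zC.
- exact: zC.
- move/forall_inP: C_chain => /(_ x); rewrite inE xC => /(_ isT)/forall_inP/(_ y).
  by rewrite inE; apply.
Qed.

(** An element between two neighbours, or below the last one, would be comparable to the whole chain
    and hence belong to it. The prefix [C1] stays in view because maximality concerns the entire
    chain. *)
Lemma maximal_chain_cover C1 p C2 :
  maximal_chain (C1 ++ p :: C2) -> cover_chain p C2.
Proof.
elim: C2 C1 p => [|q C2 IH] C1 p pC.
  have [] := maximal_chainP pC; rewrite pairwise_cat allrel_consr => /andP[/andP[C1p _] _].
  move=> C_max; apply/forallP => z; apply/negP => zp.
  have lt_z x : x \in C1 ++ [:: p] -> (z < x)%O.
    by rewrite mem_cat inE => /orP[/(allP C1p)/(lt_trans zp)|/eqP->].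
  have /lt_z : z \in C1 ++ [:: p].
    by apply: C_max => x /lt_z/ltW; rewrite comparable_sym => /le_comparable.
  by rewrite ltxx.
apply/andP; split; last by apply: (IH (rcons C1 p)); rewrite cat_rcons.
have [] := maximal_chainP pC; rewrite pairwise_cat allrel_consr /=.
move=> /and3P[/andP[C1p _] _ /andP[/andP[qp pC2] /andP[qC2 _]]] C_max.
rewrite /covered_by qp /=; apply/forallP => z; apply/negP => /andP[qz zp].
have lt_z x : x \in C1 ++ p :: q :: C2 -> (z < x)%O || (x < z)%O.
  rewrite mem_cat !inE => /or4P[/(allP C1p)/(lt_trans zp)->|/eqP->|/eqP->|xC2] //.
  - by rewrite zp.
  - by rewrite qz orbT.
  - by rewrite (lt_trans (allP qC2 _ xC2) qz) orbT.
have /lt_z : z \in C1 ++ p :: q :: C2.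
  by apply: C_max => x /lt_z/orP[]/ltW/le_comparable //; rewrite comparable_sym.
by rewrite ltxx.
Qed.

Lemma maximal_chain_top C : maximal_chain C ->
  exists2 C', C = p_max S :: C' & cover_chain (p_max S) C'.
Proof.
move=> Cmax; have [C_lt C_mem] := maximal_chainP Cmax.
have topC : p_max S \in C by apply: C_mem => x _; apply/le_comparable/le_p_max.
case: C Cmax C_lt topC {C_mem} => [//|p C] Cmax /andP[pC _]; rewrite inE.
move=> /orP[/eqP->|/(allP pC)/lt_le_trans/(_ (le_p_max p))]; last by rewrite ltxx.
by exists C => //; apply: (@maximal_chain_cover [::]).
Qed.

(** Extend the singleton of [q] to a maximal set of pairwise comparable elements and list it in
    decreasing order. *)
Lemma maximal_chain_exists q : exists2 C, maximal_chain C & q \in C.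
Proof.
have [|D D_max qD] := @maxset_exists _ (fun D : {set A} =>
    [forall x in D, forall y in D, (x >=< y)%O]) [set q]%SET.
  apply/forall_inP => x /finset.set1P->; apply/forall_inP => y /finset.set1P->.
  exact: comparablexx.
have memC x : (x \in rev (sort <=%O (enum D))) = (x \in D).
  by rewrite mem_rev mem_sort mem_enum.
exists (rev (sort <=%O (enum D))); last by rewrite memC (fintype.subsetP qD) ?inE.
split; last first.
  have -> // : [set:: rev (sort <=%O (enum D))]%SET = D.
  by apply/finset.setP => x; rewrite inE memC.
rewrite rev_sorted (_ : sorted _ _ = sorted <%O (sort <=%O (enum D))) //.
rewrite lt_sorted_uniq_le sort_uniq enum_uniq /=.
apply: (sort_sorted_in (P := mem D)); last by apply/allP => x; rewrite mem_enum.
by move=> x y xD yD; have /maxsetP[/forall_inP/(_ x xD)/forall_inP/(_ y yD)] := D_max.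
Qed.

End Chains.

(** * The minimum over all maximal chains *)

Lemma lex_le_anti (disp : Order.disp_t) (A : finPOrderType disp) (le_t : rel A)
    (a b : {ffun A -> rat}) :
  antisymmetric le_t -> lex_le le_t a b -> lex_le le_t b a -> a = b.
Proof.
move=> anti [//|[p [ne_p max_p lt_p]]] [//|[q [ne_q max_q lt_q]]].
have pq : p = q by apply: anti; rewrite max_p ?max_q // eq_sym.
by move: lt_q; rewrite -pq => /(lt_trans lt_p); rewrite ltxx.
Qed.

Theorem lemma2p10 (K : closedFieldType) (V : vectType K) (X : projVariety V)
    (disp : Order.disp_t) (A : finPOrderType disp) (S : seshadri X A)
    (le_t : rel A) (hle_t : linearization le_t) (q : A) :
  quasi_valuation S le_t (coord_res X (extremal S q)) = indic q.
Proof.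
have [_ anti _ _ le_le_t] := hle_t.
pose f := coord_res X (extremal S q).
(* The exponent 1 starts the invariant of [chain_sum_through] with [c = k = 1]. *)
have valE C : chain_valuation S (p_max S :: C) f =
    chain_sum 1 C (coord_res (S (p_max S)) (extremal S q ^+ 1))%:F.
  by rewrite /= /f restrict_res //; exact/cone_sub/strat_sub.
have through C : maximal_chain C -> q \in C -> chain_valuation S C f = indic q.
  move=> /(maximal_chain_top S)[C' -> C'P] qC.
  by rewrite valE chain_sum_through // mulr1.
have q_le C : maximal_chain C -> lex_le le_t (indic q) (chain_valuation S C f).
  move=> CP; have [qC|] := boolP (q \in C); first by left; rewrite through.
  have [C' -> C'P] := maximal_chain_top S CP; rewrite valE => qC; right.
  have [z qz [z0 z_max]] :=
    chain_sum_off S C'P (le_p_max S q) qC (ltr01 : 0 < 1 :> rat) (ltn0Sn 0).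
  have qz0 : indic q z = 0 by rewrite ffunE gt_eqF.
  exists z; rewrite qz0; split=> //; first by rewrite lt_eqF.
  (* The two functions can differ only at [q] or on the support of the chain value, and [z]
     dominates both. *)
  move=> x; rewrite ffunE; have [->|_] := eqVneq x q; first by move=> _; apply/le_le_t/ltW.
  by rewrite eq_sym => /z_max/le_le_t.
have [C CP qC] := maximal_chain_exists q.
apply: xget_unique; first by split=> //; exists C; rewrite ?through.
(* Any other minimum lies below the value of the chain through [q], so antisymmetry identifies it
   with [indic q]. *)
move=> v [[D DP ->] v_min]; apply: (lex_le_anti anti); last exact: q_le.
by rewrite -(through C) //; apply: v_min.
Qed.
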